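(* Let $\lambda$ be a nonzero real number and let $r\ge 0$ be an integer. For all integers $m,n,k\ge 0$ with $n\ge m+k$, $$\binom{m+k}{k}{n+r \brace k+m+r}_{r,\lambda}=\sum_{l=k}^{n-m}\binom{n}{l}{l \brace k}_{\lambda}{n-l+r \brace m+r}_{r,\lambda}.$$
   Context: For a nonzero real $\lambda$, the generalized falling factorials are $(x)_{0,\lambda}=1$ and $(x)_{n,\lambda}=x(x-\lambda)\cdots(x-(n-1)\lambda)$ for $n\ge 1$. The $\lambda$-analogues of Stirling numbers of the second kind ${n \brace k}_{\lambda}$ and, for an integer $r\ge 0$, the $\lambda$-analogues of $r$-Stirling numbers of the second kind ${n+r \brace k+r}_{r,\lambda}$ ($0\le k\le n$) are the real numbers uniquely determined by the polynomial identities in $x$ $$x^{n}=\sum_{k=0}^{n}{n \brace k}_{\lambda}(x)_{k,\lambda},\qquad (x+r)^{n}=\sum_{k=0}^{n}{n+r \brace k+r}_{r,\lambda}(x)_{k,\lambda},\quad n\ge 0.$$ (So ${n+r \brace k+m+r}_{r,\lambda}$ is the coefficient of $(x)_{k+m,\lambda}$ in $(x+r)^n$, and ${n-l+r \brace m+r}_{r,\lambda}$ is the coefficient of $(x)_{m,\lambda}$ in $(x+r)^{n-l}$.) *)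

(* Defs.v *)
From HB Require Import structures.
From mathcomp Require Import all_boot all_order all_algebra.
From mathcomp Require Import reals.

Set Implicit Arguments.
Unset Strict Implicit.
Unset Printing Implicit Defensive.

Import GRing.Theory.
Local Open Scope ring_scope.

(* (x)_{k,lam} = x (x - lam) ... (x - (k - 1) lam), as a polynomial in x = 'X *)
Definition gffact (R : comNzRingType) (lam : R) (k : nat) : {poly R} :=
  \prod_(i < k) ('X - (i%:R * lam)%:P).

Lemma gffact_monic (R : comNzRingType) (lam : R) (k : nat) :
  gffact lam k \is monic.
Proof. by apply: monic_prod => i _; apply: monicXsubC. Qed.

Lemma size_gffact (R : comNzRingType) (lam : R) (k : nat) :
  size (gffact lam k) = k.+1.
Proof. by rewrite /gffact size_prod_XsubC /index_enum -enumT size_enum_ord. Qed.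

Lemma gffact_lead (R : comNzRingType) (lam : R) (k : nat) :
  (gffact lam k)`_k = 1.
Proof. by have /monicP := gffact_monic lam k; rewrite lead_coefE size_gffact. Qed.

Lemma size_sum_gffact (R : comNzRingType) (lam : R) (n : nat) (c : nat -> R) :
  (size (\sum_(k < n) c k *: gffact lam k)%R <= n)%N.
Proof.
apply: leq_trans (size_sum _ _ _) _; apply/bigmax_leqP => k _.
by apply: leq_trans (size_scale_leq _ _) _; rewrite size_gffact.
Qed.

(* The (x)_{k,lam} form a basis of the polynomials in x.  A finite family of
   coordinates is stored as the coefficient sequence of a polynomial c. *)
Lemma gffact_coord_ex (R : comNzRingType) (lam : R) (n : nat) (p : {poly R}) :
  (size p <= n)%N ->
  exists c : {poly R},
    (size c <= n)%N && (p == \sum_(k < n) c`_k *: gffact lam k).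
Proof.
elim: n p => [|n IHn] p sp.
  by exists 0; rewrite size_poly0 big_ord0 -size_poly_eq0 -leqn0.
have sq : (size (p - p`_n *: gffact lam n)%R <= n)%N.
  apply/leq_sizeP => j; rewrite leq_eqVlt => /predU1P[<-|ltnj].
    by rewrite coefB coefZ gffact_lead mulr1 subrr.
  rewrite coefB coefZ (nth_default _ (leq_trans sp ltnj)).
  by rewrite (@nth_default _ _ (gffact lam n)) ?size_gffact // mulr0 subr0.
have [c /andP[sc /eqP cE]] := IHn _ sq.
exists (c + p`_n *: 'X^n); apply/andP; split.
  apply: leq_trans (size_polyD _ _) _; rewrite geq_max (leqW sc) /=.
  by apply: leq_trans (size_scale_leq _ _) _; rewrite size_polyXn.
rewrite big_ord_recr /= coefD coefZ coefXn eqxx mulr1 (nth_default _ sc) add0r.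
rewrite -subr_eq; apply/eqP; rewrite cE.
apply: eq_bigr => k _; rewrite coefD coefZ coefXn.
by rewrite (ltn_eqF (ltn_ord k)) mulr0 addr0.
Qed.

Lemma gffact_coord_uniq (R : comNzRingType) (lam : R) (n : nat)
    (c d : nat -> R) :
  \sum_(k < n) c k *: gffact lam k = \sum_(k < n) d k *: gffact lam k ->
  forall k, (k < n)%N -> c k = d k.
Proof.
elim: n => [|n IHn] // eq_cd.
have cn (e : nat -> R) : (\sum_(k < n.+1) e k *: gffact lam k)`_n = e n.
  rewrite big_ord_recr coefD coefZ gffact_lead mulr1.
  by rewrite nth_default ?add0r ?size_sum_gffact.
have eqn : c n = d n by rewrite -cn eq_cd cn.
move: eq_cd; rewrite !big_ord_recr /= eqn => /addIr /IHn eq_cd k.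
by rewrite ltnS leq_eqVlt => /predU1P[->|/eq_cd].
Qed.

(* The coefficient of (x)_{k,lam} in p. *)
Definition gffact_coef (R : comNzRingType) (lam : R) (p : {poly R}) (k : nat) :
    R :=
  (xchoose (gffact_coord_ex lam (leqnn (size p))))`_k.

Lemma gffact_coefE (R : comNzRingType) (lam : R) (n : nat) (p : {poly R}) :
  (size p <= n)%N ->
  p = \sum_(k < n) gffact_coef lam p k *: gffact lam k.
Proof.
move=> sp; have /andP[sc /eqP cE] :=
  xchooseP (gffact_coord_ex lam (leqnn (size p))).
rewrite {1}cE (big_ord_widen n (fun k => _`_k *: gffact lam k) sp) big_mkcond.
apply: eq_bigr => k _; case: ltnP => // lepk.
by rewrite /gffact_coef nth_default ?scale0r // (leq_trans sc).
Qed.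

Lemma gffact_coefP (R : comNzRingType) (lam : R) (n : nat) (p : {poly R})
    (c : nat -> R) :
  p = \sum_(k < n) c k *: gffact lam k ->
  forall k, (k < n)%N -> c k = gffact_coef lam p k.
Proof.
move=> pE; apply: (gffact_coord_uniq (lam := lam)); rewrite -pE.
by apply: gffact_coefE; rewrite pE size_sum_gffact.
Qed.

(* {n brace k}_lam *)
Definition lstirling2 (R : realType) (lam : R) (n k : nat) : R :=
  gffact_coef lam 'X^n k.

(* {n + r brace k + r}_{r,lam}: the arguments n and k are the entries of the
   bracket with r subtracted. *)
Definition lrstirling2 (R : realType) (lam : R) (r n k : nat) : R :=
  gffact_coef lam (('X + (r%:R)%:P) ^+ n) k.

Lemma lstirling2E (R : realType) (lam : R) (n : nat) :
  'X^n = \sum_(k < n.+1) lstirling2 lam n k *: gffact lam k.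
Proof. by apply: gffact_coefE; rewrite size_polyXn. Qed.

Lemma lrstirling2E (R : realType) (lam : R) (r n : nat) :
  ('X + (r%:R)%:P) ^+ n =
  \sum_(k < n.+1) lrstirling2 lam r n k *: gffact lam k.
Proof.
apply: gffact_coefE.
by rewrite -[_%:P]opprK -polyCN size_exp_XsubC.
Qed.

Lemma lstirling2P (R : realType) (lam : R) (n : nat) (c : nat -> R) :
  'X^n = \sum_(k < n.+1) c k *: gffact lam k ->
  forall k, (k <= n)%N -> c k = lstirling2 lam n k.
Proof. exact: gffact_coefP. Qed.

Lemma lrstirling2P (R : realType) (lam : R) (r n : nat) (c : nat -> R) :
  ('X + (r%:R)%:P) ^+ n = \sum_(k < n.+1) c k *: gffact lam k ->
  forall k, (k <= n)%N -> c k = lrstirling2 lam r n k.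
Proof. exact: gffact_coefP. Qed.

(* Main.v *)
(* Multiplication by X + c acts on the basis (x)_{k,lam} by
   (X + c) (x)_k = (x)_{k+1} + (k lam + c) (x)_k, which gives a triangular
   recurrence in n for the coordinates of (X + c)^n.  The binomial convolution
   of the coordinates of (X + c)^l and (X + d)^(n-l) obeys a Leibniz rule, and
   Pascal's rule shows that it satisfies the same recurrence in n as
   binom(m+k, k) times the coordinates of (X + (c + d))^n. *)
Require Import Defs.
From mathcomp Require Import all_boot all_order all_algebra.
From mathcomp Require Import reals.
From mathcomp Require Import ring.

Import GRing.Theory.
Local Open Scope ring_scope.

Lemma gffactS (R : comNzRingType) (lam : R) (k : nat) :
  gffact lam k.+1 = gffact lam k * ('X - (k%:R * lam)%:P).
Proof. by rewrite /gffact big_ord_recr. Qed.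

Lemma gffact_coef_gt_size (R : comNzRingType) (lam : R) (p : {poly R})
    (k : nat) :
  (size p <= k)%N -> gffact_coef lam p k = 0.
Proof.
move=> sp; rewrite /gffact_coef; have /andP[sc _] :=
  xchooseP (gffact_coord_ex lam (leqnn (size p))).
exact: nth_default (leq_trans sc sp).
Qed.

Lemma gffact_coef1 (R : comNzRingType) (lam : R) (k : nat) :
  gffact_coef lam 1 k = (k == 0)%:R.
Proof.
case: k => [|k]; last by rewrite gffact_coef_gt_size // size_poly1.
rewrite -(@gffact_coefP _ lam 1 1 (fun=> 1)) //.
by rewrite big_ord1 /gffact big_ord0 scale1r.
Qed.

Lemma gffact_coef_mulXaddC (R : comNzRingType) (lam c : R) (p : {poly R})
    (k : nat) :
  gffact_coef lam (p * ('X + c%:P)) k =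
  (if k is k'.+1 then gffact_coef lam p k' else 0) +
  (k%:R * lam + c) * gffact_coef lam p k.
Proof.
pose a := gffact_coef lam p.
pose e j := (if j is j'.+1 then a j' else 0) + (j%:R * lam + c) * a j.
(* Taking the maximum with [k] puts [k] among the [N.+2] indices; since [a N.+1 = 0], the unshifted
   sum extends to that range for free. *)
pose N := maxn (size p) k.
have aN : a N.+1 = 0 by rewrite /a gffact_coef_gt_size // leqW // leq_maxl.
rewrite -[RHS]/(e k); apply/esym.
apply: (@gffact_coefP _ lam N.+2 _ e); last by rewrite ltnS leqW // leq_maxr.
rewrite {1}(@gffact_coefE _ lam N.+1 p); last by rewrite leqW // leq_maxl.
transitivity (\sum_(j < N.+1) a j *: gffact lam j.+1 +
  \sum_(j < N.+1) ((j%:R * lam + c) * a j) *: gffact lam j).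
  rewrite mulr_suml -big_split; apply: eq_bigr => j _ /=.
  by rewrite gffactS /a -!mul_polyC 2!polyCM polyCD !polyCM; ring.
under [RHS]eq_bigr do rewrite scalerDl.
rewrite big_split /=; congr (_ + _).
  by rewrite [RHS]big_ord_recl /= scale0r add0r.
by rewrite [RHS]big_ord_recr /= aN mulr0 scale0r addr0.
Qed.

(** Leibniz rule, from Pascal's rule on ['C(n.+1, l)]: each sum advances only one factor, so the
    recurrence in the exponent applies to that factor alone. *)
Lemma binomial_convolutionS (R : comNzRingType) (a b : nat -> R) (n : nat) :
  \sum_(l < n.+2) 'C(n.+1, l)%:R * a l * b (n.+1 - l)%N =
  \sum_(l < n.+1) 'C(n, l)%:R * a l.+1 * b (n - l)%N +
  \sum_(l < n.+1) 'C(n, l)%:R * a l * b (n - l).+1.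
Proof.
rewrite big_ord_recl bin0 subn0 /=.
under eq_bigr do rewrite /bump /= add1n subSS binS natrD !mulrDl.
rewrite big_split /= addrA addrC; congr (_ + _).
(* The top term carries ['C(n, n.+1) = 0]; the isolated term [l = 0] becomes the first term of the
   second sum. *)
rewrite big_ord_recr /= bin_small // !mul0r addr0.
rewrite [RHS]big_ord_recl bin0 subn0; congr (_ + _).
by apply: eq_bigr => i _; rewrite /= /bump /= add1n subnSK.
Qed.

(** Induction on [n]: the diagonal factors [k lam + c] and [m lam + d] add up to
    [(m + k) lam + (c + d)], while the shifted terms, at [(m, k - 1)] and [(m - 1, k)], merge by
    Pascal's rule on ['C(m + k, k)]. *)
Lemma gffact_coef_exp_convolution (R : comNzRingType) (lam c d : R)
    (n m k : nat) :
  \sum_(l < n.+1) 'C(n, l)%:R * gffact_coef lam (('X + c%:P) ^+ l) k *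
    gffact_coef lam (('X + d%:P) ^+ (n - l)) m =
  'C(m + k, k)%:R * gffact_coef lam (('X + (c + d)%:P) ^+ n) (m + k).
Proof.
elim: n m k => [|n IHn] m k.
  rewrite big_ord1 !expr0 !gffact_coef1 bin0 mul1r.
  by case: m k => [|m] [|k]; rewrite ?binn ?addn0 ?mulr0 ?mul0r.
rewrite (@binomial_convolutionS _
  (fun l => gffact_coef lam (('X + c%:P) ^+ l) k)
  (fun l => gffact_coef lam (('X + d%:P) ^+ l) m)).
under eq_bigr do rewrite exprSr gffact_coef_mulXaddC mulrDr mulrDl.
under [X in _ + X]eq_bigr do rewrite exprSr gffact_coef_mulXaddC mulrDr.
rewrite !big_split /= exprSr gffact_coef_mulXaddC.
have scale_l x : \sum_(l < n.+1) 'C(n, l)%:R *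
    (x * gffact_coef lam (('X + c%:P) ^+ l) k) *
    gffact_coef lam (('X + d%:P) ^+ (n - l)) m =
  x * ('C(m + k, k)%:R * gffact_coef lam (('X + (c + d)%:P) ^+ n) (m + k)).
  by rewrite -IHn mulr_sumr; apply: eq_bigr => l _; ring.
have scale_r x : \sum_(l < n.+1) 'C(n, l)%:R *
    gffact_coef lam (('X + c%:P) ^+ l) k *
    (x * gffact_coef lam (('X + d%:P) ^+ (n - l)) m) =
  x * ('C(m + k, k)%:R * gffact_coef lam (('X + (c + d)%:P) ^+ n) (m + k)).
  by rewrite -IHn mulr_sumr; apply: eq_bigr => l _; ring.
rewrite scale_l scale_r natrD.
(* At [k = 0] or [m = 0] the corresponding shifted coordinate is the default 0. *)
have zero_l : \sum_(l < n.+1) 'C(n, l)%:R * 0 *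
    gffact_coef lam (('X + d%:P) ^+ (n - l)) m = 0.
  by apply: big1 => l _; rewrite mulr0 mul0r.
have zero_r : \sum_(l < n.+1) 'C(n, l)%:R *
    gffact_coef lam (('X + c%:P) ^+ l) k * 0 = 0.
  by apply: big1 => l _; rewrite mulr0.
case: k m {scale_l scale_r} zero_l zero_r => [|k] [|m] zero_l zero_r.
- by rewrite zero_l zero_r addn0 /=; ring.
- by rewrite zero_l IHn !addn0 !bin0 /=; ring.
- by rewrite zero_r IHn !add0n !binn /=; ring.
- by rewrite !IHn addSnnS addSn binS natrD /=; ring.
Qed.

Theorem theorem5 (R : realType) (lam : R) (lam_neq0 : lam != 0)
    (r m n k : nat) (le_mk_n : (m + k <= n)%N) :
  'C(m + k, k)%:R * lrstirling2 lam r n (k + m) =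
  \sum_(k <= l < (n - m).+1)
    'C(n, l)%:R * lstirling2 lam l k * lrstirling2 lam r (n - l) m.
Proof.
have coef_small (c : R) j i : (j < i)%N ->
    gffact_coef lam (('X + c%:P) ^+ j) i = 0.
  move=> lt_ji; apply: gffact_coef_gt_size.
  by rewrite -[_%:P]opprK -polyCN size_exp_XsubC.
(* With [c = 0] the powers of ['X] give the numbers without [r], and [d = r] gives the [r]-version
   on both sides. *)
have := @gffact_coef_exp_convolution _ lam 0 r%:R n m k.
rewrite add0r addr0 [(k + m)%N]addnC /lrstirling2 => <-.
rewrite -(big_mkord xpredT (fun l => 'C(n, l)%:R *
  gffact_coef lam ('X ^+ l) k *
  gffact_coef lam (('X + r%:R%:P) ^+ (n - l)) m)).
have le_mn : (m <= n)%N := leq_trans (leq_addr _ _) le_mk_n.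
have le_k : (k <= (n - m).+1)%N by rewrite leqW // leq_subRL.
(* The full range of [l] is cut at [k] and after [n - m]. Below [k] the power of degree [l] has no
   [k]-th coordinate; above [n - m] the power of degree [n - l < m] has no [m]-th one. *)
rewrite (big_cat_nat (leq0n k)) /=; last first.
  by rewrite (leq_trans le_k) // ltnS leq_subr.
rewrite big_nat big1 ?add0r => [|l /andP[_ lt_lk]]; last first.
  by rewrite -['X]addr0 -[0]polyC0 coef_small // mulr0 mul0r.
rewrite (big_cat_nat le_k) ?ltnS ?leq_subr //=.
rewrite [X in _ + X]big_nat [X in _ + X]big1 ?addr0 // => l /andP[lt_l le_l].
rewrite [X in _ * X]coef_small ?mulr0 //.
by rewrite ltn_subLR // addnC -ltn_subLR.
Qed.
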